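(* Let $f\in\Gamma_0(X)$ with $Y\cap\operatorname{dom} f^*\neq\varnothing$, and let $(e,d)=(e_f,d_f)\in Y\times Y$ be the pair defined in the context. Consider the Attouch--Th\'era primal-dual inclusion problem $$(P)\quad \text{find } x\in X \text{ such that } 0\in\partial\,\mathrm{cl}(f\,\Box\,\iota_{Y^\perp})(x)+(\mathrm{Id}-R)x,$$ $$(D)\quad \text{find } y\in X \text{ such that } 0\in\partial(f^*+\iota_Y)(y)+(\mathrm{Id}-R)^{-1}y.$$ Then the following hold: (i) $(e,d)$ is a solution to the primal-dual problem $(P)$--$(D)$, i.e., $e$ solves $(P)$ and $d$ solves $(D)$. Moreover, $d$ is the unique solution of $(D)$. (ii) $(e,d)$ is the unique solution of the primal-dual problem $$(P')\quad 0\in\partial\,\mathrm{cl}(f\,\Box\,\iota_{Y^\perp})(x)+(\mathrm{Id}-R)x\ \text{ and }\ x\in Y,$$ $$(D')\quad 0\in\partial(f^*+\iota_Y)(y)+(\mathrm{Id}-R)^{-1}y.$$ More specifically, $e$ is the unique solution of $(P')$ and $d$ is the unique solution of $(D')$.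
   Context: $X$ is a real Hilbert space with inner product $\langle\cdot,\cdot\rangle$. $m\in\{1,2,\dots\}$ and $R:X\to X$ is a linear isometry with $R^m=\mathrm{Id}$. $\operatorname{Fix}R=\{x: Rx=x\}$, $Y=(\operatorname{Fix}R)^\perp$ (so $Y^\perp=\operatorname{Fix}R$), $S=R-\mathrm{Id}$, $Q=\frac1m\sum_{i=1}^{m-1}iR^i$. $\Gamma_0(X)$ is the set of proper lower semicontinuous convex functions $X\to\,]-\infty,+\infty]$. $f^*(x^* )=\sup_{x\in X}(\langle x,x^*\rangle-f(x))$ is the Fenchel conjugate; $\operatorname{dom}f=\{f<+\infty\}$; $(f\,\Box\,g)(x)=\inf_{y\in X}(f(y)+g(x-y))$ is the infimal convolution; $\mathrm{cl}\,f$ is the lower semicontinuous convex hull of $f$ (largest lower semicontinuous convex function $\le f$); $\partial f(x)=\{x^*: f(y)\ge f(x)+\langle x^*,y-x\rangle\ \forall y\in X\}$ is the subdifferential; $\iota_C$ is the indicator function ($0$ on $C$, $+\infty$ off $C$). $(\mathrm{Id}-R)^{-1}$ is the set-valued inverse: $(\mathrm{Id}-R)^{-1}y=\{x\in X: x-Rx=y\}$. The pair $(e_f,d_f)$: for $f\in\Gamma_0(X)$ with $Y\cap\operatorname{dom}f^*\ne\varnothing$, there is a unique pair $(e,d)\in Y\times Y$ such that $d=Se\in\operatorname{dom}f^*$, $e=Qd$, and $f^*(Se)+\langle y-Se,e\rangle-f^*(y)\le0$ for all $y\in Y$ (equivalently, $e\in\partial(f^*+\iota_Y)(Se)$); it is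 denoted $(e_f,d_f)$. *)

(* Defs.v *)
From HB Require Import structures.
From mathcomp Require Import all_boot all_order all_algebra sesquilinear.
From mathcomp Require Import all_classical all_reals all_analysis.

Set Implicit Arguments.
Unset Strict Implicit.
Unset Printing Implicit Defensive.

Import Order.TTheory GRing.Theory Num.Theory.
Import numFieldNormedType.Exports.

Local Open Scope classical_set_scope.
Local Open Scope ring_scope.

Section ConvexAnalysis.
Context {K : realType} {X : completeNormedModType K}.
Local Open Scope ereal_scope.
Implicit Types f g : X -> \bar K.

Definition dom f : set X := [set x | f x < +oo].

Definition epigraph f : set (X * K^o)%type := [set p | f p.1 <= p.2%:E].

(* Convexity through the epigraph also covers functions that take the values
   -oo and +oo. *)
Definition convex_efun f : Prop := @convex_set K (X * K^o)%type (epigraph f).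

Definition proper_efun f : Prop :=
  (forall x, f x != -oo) /\ dom f !=set0.

Definition Gamma0 : set (X -> \bar K) :=
  [set f | [/\ proper_efun f, lower_semicontinuous f & convex_efun f]].

Definition indic_fun (C : set X) : X -> \bar K :=
  fun x => if x \in C then 0 else +oo.

(* In \bar K, (+oo) + (-oo) = -oo, so this is the usual infimal convolution
   only for functions that do not take the value -oo. *)
Definition inf_conv f g : X -> \bar K :=
  fun x => ereal_inf [set f y + g (x - y)%R | y in [set: X]].

Definition lsc_convex_minorant f : set (X -> \bar K) :=
  [set h | [/\ lower_semicontinuous h, convex_efun h & forall x, h x <= f x]].

Definition lsc_convex_hull f : X -> \bar K :=
  fun x => ereal_sup [set h x | h in lsc_convex_minorant f].

(* The pointwise supremum above is the largest element of the set of
   lower semicontinuous convex minorants. *)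
Lemma lsc_convex_hull_minorant f :
  lsc_convex_minorant f (lsc_convex_hull f).
Proof.
split.
- move=> x a /ereal_sup_gt[_ [h hf <-]] ahx.
  have [hlsc _ _] := hf.
  have [V Vx Va] := hlsc x a ahx.
  exists V => // y Vy; apply: (lt_le_trans (Va y Vy)).
  by apply: ereal_sup_ubound; exists h.
- have epiP (p : X * K^o) : epigraph (lsc_convex_hull f) p <->
      forall h, lsc_convex_minorant f h -> epigraph h p.
    split=> [hp h hf|hp].
      by apply: le_trans hp; apply: ereal_sup_ubound; exists h.
    by apply: ge_ereal_sup => _ [h hf <-]; exact: hp.
  move=> p q t /set_mem/epiP hp /set_mem/epiP hq; apply/mem_set/epiP => h hf.
  by have [_ hc _] := hf; apply/set_mem/hc; apply/mem_set; [exact: hp|exact: hq].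
- by move=> x; apply: ge_ereal_sup => _ [h [_ _ hf] <-].
Qed.

Lemma lsc_convex_hull_largest f h :
  lsc_convex_minorant f h -> forall x, h x <= lsc_convex_hull f x.
Proof. by move=> hf x; apply: ereal_sup_ubound; exists h. Qed.

Variable ip : {dot X for idfun}.

Definition fenchel_conj f : X -> \bar K :=
  fun u => ereal_sup [set (ip x u)%:E - f x | x in [set: X]].

Definition subdiff f (x : X) : set X :=
  [set u | forall y, f x + (ip u (y - x)%R)%:E <= f y].

Definition orthocomp (A : set X) : set X :=
  [set x | forall z, A z -> ip x z = 0%R].

End ConvexAnalysis.

Section SetValued.
Context {V : zmodType}.

Definition inverse_op (A : V -> set V) : V -> set V := fun y => [set x | A x y].

Definition zero_in_sum (A B : V -> set V) (x : V) : Prop :=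
  [set u + v | u in A x & v in B x] 0.

End SetValued.

Section Isometry.
Context {K : realType} {X : completeNormedModType K}.
Variables (ip : {dot X for idfun}) (m : nat) (R : X -> X).

Definition fix_set : set X := [set x | R x = x].

Definition spaceY : set X := orthocomp ip fix_set.

Definition opS (x : X) : X := R x - x.

Definition opQ (x : X) : X := m%:R^-1 *: \sum_(1 <= i < m) i%:R *: iter i R x.

Definition opIdR : X -> set X := fun x => [set x - R x].

Definition is_ed_pair (f : X -> \bar K) (e d : X) : Prop :=
  [/\ spaceY e, spaceY d,
      d = opS e /\ dom (fenchel_conj ip f) d,
      e = opQ d &
      forall y, spaceY y ->
        (fenchel_conj ip f (opS e) + (ip (y - opS e)%R e)%:E
           - fenchel_conj ip f y <= 0)%E].

Definition primal_sol (f : X -> \bar K) : X -> Prop :=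
  zero_in_sum
    (subdiff ip (lsc_convex_hull (inf_conv f (indic_fun (orthocomp ip spaceY)))))
    opIdR.

Definition dual_sol (f : X -> \bar K) : X -> Prop :=
  zero_in_sum
    (subdiff ip (fun y => fenchel_conj ip f y + indic_fun spaceY y)%E)
    (inverse_op opIdR).

End Isometry.

(* Main.v *)
Require Import Defs.
From HB Require Import structures.
From mathcomp Require Import all_boot all_order all_algebra sesquilinear.
From mathcomp Require Import all_classical all_reals all_analysis.
From mathcomp Require Import ring lra.

Set Implicit Arguments.
Unset Strict Implicit.
Unset Printing Implicit Defensive.

Import Order.TTheory GRing.Theory Num.Theory.
Import numFieldNormedType.Exports.

Local Open Scope classical_set_scope.
Local Open Scope ring_scope.

(** Write [h] for the sum of the conjugate of [f] and the indicator of [Y], and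
    [k] for the closed convex hull of the infimal convolution of [f] with the
    indicator of the orthogonal complement of [Y].  The two problems amount to
      primal: [S x] is a subgradient of [k] at [x];
      dual: some subgradient [u] of [h] at [y] satisfies [y = S u].

    Existence.  The inequality defining the pair says that [e] is a subgradient
    of [h] at [d = S e], which is the dual inclusion.  Since [h] is the
    conjugate of [k] ([fenchel_conj_inf_conv]), the primal inclusion is the same
    relation read backwards through conjugation ([subdiff_fenchel_conj]); this
    inversion is where closedness matters, through the inequality of [k] with
    its biconjugate ([le_biconjugate]).

    The biconjugate inequality is obtained without separating convex sets.  A
    strongly convex regularization of [k] centred at [x0] attains its minimum
    because the parallelogram identity makes minimizing sequences Cauchy
    ([prox_minimizer]); the minimizer [p] carries a subgradient proportional to
    [x0 - p] ([prox_subgradient]), hence an affine minorant of [k] that is exact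
    at [p].  As the penalty grows, [p] tends to [x0], and lower semicontinuity
    carries the bound from [p] to [x0].

    Uniqueness.  Subdifferentials are monotone, whereas [S = R - Id] is
    dissipative for an isometry [R]: twice the inner product of [S w] and [w] is
    minus the squared norm of [S w].  Applied to the difference [w] of two
    solutions (primal points, or subgradients attached to dual points), these
    opposite signs force [S w = 0].  On the dual side this says that the two
    points coincide; on the primal side it says that [w] is fixed by [R], and
    [w = 0] as soon as [w] also lies in [Y]. *)

Section RealHilbert.
Context {K : realType} {X : completeNormedModType K}.
Variable ip : {dot X for idfun}.
Hypothesis ip_norm : forall x : X, ip x x = `|x| ^+ 2.
Implicit Types (x y z u v w : X) (k g : X -> \bar K).

(** * Inner product calculus *)

Lemma ipC x y : ip x y = ip y x.
Proof. by rewrite hermitian_subproof expr0 mul1r. Qed.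

Lemma ipDl x y z : ip (x + y) z = ip x z + ip y z.
Proof. exact: linearDl. Qed.

Lemma ipZl (t : K) x z : ip (t *: x) z = t * ip x z.
Proof. exact: linearZl_LR. Qed.

Lemma ipNl x z : ip (- x) z = - ip x z.
Proof. by rewrite linearNl. Qed.

Lemma ipBl x y z : ip (x - y) z = ip x z - ip y z.
Proof. exact: linearBl. Qed.

Lemma ipDr x y z : ip x (y + z) = ip x y + ip x z.
Proof. exact: linearDr. Qed.

Lemma ipBr x y z : ip x (y - z) = ip x y - ip x z.
Proof. exact: linearBr. Qed.

Lemma ipZr (t : K) x z : ip x (t *: z) = t * ip x z.
Proof. by rewrite ipC ipZl ipC. Qed.

Lemma sqr_normD x y : `|x + y| ^+ 2 = `|x| ^+ 2 + ip x y *+ 2 + `|y| ^+ 2.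
Proof. by rewrite -!ip_norm !(ipDl, ipDr) (ipC y x); ring. Qed.

Lemma sqr_normB x y : `|x - y| ^+ 2 = `|x| ^+ 2 - ip x y *+ 2 + `|y| ^+ 2.
Proof. by rewrite -!ip_norm !(ipBl, ipBr) (ipC y x); ring. Qed.

(** Nonnegativity of the squared norm of [`|y| *: x - `|x| *: y]. *)
Lemma cauchy_schwarz x y : ip x y <= `|x| * `|y|.
Proof.
have [->|x0] := eqVneq x 0; first by rewrite linear0l normr0 mul0r.
have [->|y0] := eqVneq y 0; first by rewrite linear0r normr0 mulr0.
have xy0 : 0 < `|x| * `|y| by rewrite mulr_gt0 ?normr_gt0.
have := sqr_ge0 `| `|y| *: x - `|x| *: y |.
rewrite sqr_normB ipZl ipZr !normrZ !normr_id => h.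
by rewrite -(ler_pM2l xy0); nra.
Qed.

(** * The proximal point *)

Lemma convex_efun_segment k x y (r s t : K) : convex_efun k -> 0 <= t <= 1 ->
  (k x <= r%:E)%E -> (k y <= s%:E)%E ->
  (k (x + t *: (y - x))%R <= (r + t * (s - r))%:E)%E.
Proof.
move=> kc /andP[t0 t1] hx hy.
have := kc (y, s) (x, r) (Itv01 t0 t1) (mem_set hy) (mem_set hx).
move=> /set_mem; rewrite /epigraph /=.
have -> : x + t *: (y - x) = t *: y + (1 - t) *: x.
  by rewrite scalerBl scale1r scalerBr addrCA.
suff -> : r + t * (s - r) = t * s + (1 - t) * r by [].
by ring.
Qed.

(** The epigraph is sequentially closed.  The limiting argument runs over the
    real numbers below [k x], so that [k x] may be infinite. *)
Lemma lsc_cvg_le k (x_ : X ^nat) (r_ : K ^nat) x (r : K) :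
  lower_semicontinuous k -> x_ n @[n --> \oo] --> x ->
  r_ n @[n --> \oo] --> r -> (forall n, (k (x_ n) <= (r_ n)%:E)%E) ->
  (k x <= r%:E)%E.
Proof.
move=> klsc xx rr kr.
suff above (a : K) : (a%:E < k x)%E -> a <= r.
  case: (k x) above => [v|/(_ (r + 1) (ltry _))|_]; last exact: leNye.
    move=> above; rewrite lee_fin leNgt; apply/negP => rv.
    by have := above _ (midf_lt rv).2; rewrite leNgt (midf_lt rv).1.
  by rewrite leNgt ltrDl ltr01.
move=> /klsc[V Vx Va]; apply: (cvgr_to_ge rr); near=> n.
rewrite -lee_fin; apply: le_trans (kr n); apply/ltW/Va.
by near: n; exact: xx.
Unshelve. all: by end_near. Qed.

(** The affine minorant bounds the regularized function below, and strong
    convexity turns almost minimality of two points into closeness.  Minimality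
    is expressed over the epigraph so that only real values are compared. *)
Lemma prox_minimizer k a (b : K) x0 (c : K) : 0 < c ->
    lower_semicontinuous k -> convex_efun k -> dom k !=set0 ->
    (forall x, ((ip x a - b)%:E <= k x)%E) ->
  exists p (r : K), (k p <= r%:E)%E /\
    forall y (s : K), (k y <= s%:E)%E ->
      r + c / 2 * `|p - x0| ^+ 2 <= s + c / 2 * `|y - x0| ^+ 2.
Proof.
move=> c0 klsc kc [z kz] minor.
pose A := [set F | exists x (r : K), (k x <= r%:E)%E /\ F = r + c / 2 * `|x - x0| ^+ 2].
have c20 : 0 < c / 2 by rewrite divr_gt0.
have infA : has_inf A.
  split.
    exists (fine (k z) + c / 2 * `|z - x0| ^+ 2), z, (fine (k z)); split=> //.
    by have := minor z; move: kz; rewrite /dom /=; case: (k z).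
  (* The minimum of the affine minorant plus the quadratic penalty, found by
     completing the square. *)
  exists (ip x0 a - b - (2 * c)^-1 * `|a| ^+ 2) => _ [x [r [kxr ->]]].
  have := le_trans (minor x) kxr; rewrite lee_fin => rge.
  have := sqr_ge0 `|c *: (x - x0) + a|.
  rewrite (sqr_normD (c *: _)) normrZ (gtr0_norm c0) ipZl ipBl => sq.
  rewrite -(ler_pM2l (mulr_gt0 (ltr0n _ 2) c0)).
  have -> : 2 * c * (ip x0 a - b - (2 * c)^-1 * `|a| ^+ 2) =
    2 * c * (ip x0 a - b) - `|a| ^+ 2 by field; lra.
  rewrite exprMn in sq; nra.
pose M := inf A.
have FM x (r : K) : (k x <= r%:E)%E -> M <= r + c / 2 * `|x - x0| ^+ 2.
  by move=> kxr; apply: ge_inf; [exact: infA.2|exists x, r].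
have /choice[w w_spec] (n : nat) : exists xr : X * K,
    (k xr.1 <= xr.2%:E)%E /\ xr.2 + c / 2 * `|xr.1 - x0| ^+ 2 < M + n.+1%:R^-1.
  have n0 : 0 < n.+1%:R^-1 :> K by rewrite invr_gt0 ltr0n.
  by have [_ [x [r [kxr ->]]] h] := inf_adherent n0 infA; exists (x, r).
pose x_ n := (w n).1; pose r_ n := (w n).2.
have k_ n : (k (x_ n) <= (r_ n)%:E)%E := (w_spec n).1.
have F_ n : r_ n + c / 2 * `|x_ n - x0| ^+ 2 < M + n.+1%:R^-1 := (w_spec n).2.
(* The regularized value at the midpoint is at least [M], so the parallelogram
   identity bounds the distance by the excess of the two values over [M]. *)
have close N n : (N <= n)%N -> `|x_ n - x_ N| ^+ 2 < 8 / c * N.+1%:R^-1.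
  move=> Nn; have nN : n.+1%:R^-1 <= N.+1%:R^-1 :> K.
    by rewrite lef_pV2 ?posrE ?ltr0n// ler_nat.
  have h01 : 0 <= (2^-1 : K) <= 1 by lra.
  have := FM _ _ (convex_efun_segment kc h01 (k_ N) (k_ n)).
  have -> : x_ n - x_ N = (x_ n - x0) - (x_ N - x0).
    by rewrite opprB addrA subrK.
  rewrite (addrAC (x_ N)) (sqr_normD (x_ N - x0)) normrZ exprMn ger0_norm//.
  rewrite ipZr ipBr ip_norm (sqr_normB (x_ n - x0)) (ipC (x_ n - x0)).
  move=> mid; rewrite mulrAC ltr_pdivlMr// mulrC.
  by move: mid nN (F_ N) (F_ n); move: (N.+1%:R^-1) (n.+1%:R^-1) => iN i_n; nra.
have /cauchy_cvg/cvg_ex[p xp] : cauchy (x_ @ \oo).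
  apply: cauchy_exP => eps eps0.
  have eps1 : 0 < c / 8 * eps ^+ 2 by rewrite !mulr_gt0 ?exprn_gt0 ?invr_gt0.
  have [N _ /(_ N (leqnn _)) hN] := near_infty_natSinv_lt (PosNum eps1).
  exists (x_ N), N => // n /= Nn; rewrite -ball_normE /= distrC.
  rewrite -(ltr_pXn2r (n := 2)) ?nnegrE ?(ltW eps0)//.
  apply: lt_trans (close _ _ Nn) _.
  have -> : eps ^+ 2 = 8 / c * (c / 8 * eps ^+ 2) by field; lra.
  by rewrite ltr_pM2l ?divr_gt0//.
(* This height is the limit of the heights of the minimizing sequence. *)
exists p, (M - c / 2 * `|p - x0| ^+ 2); split; last first.
  by move=> y s /FM; rewrite subrK.
apply: (lsc_cvg_le (x_ := x_)
    (r_ := fun n => M + n.+1%:R^-1 - c / 2 * `|x_ n - x0| ^+ 2)) => //; last first.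
  by move=> n; apply: le_trans (k_ n) _; rewrite lee_fin lerBrDr ltW.
apply: cvgB.
  rewrite -[X in _ --> X]addr0; apply: cvgD; first exact: cvg_cst.
  exact: cvg_harmonic.
apply: cvgM; first exact: cvg_cst.
by rewrite expr2; apply: cvgM; apply: cvg_norm; apply: cvgB => //; exact: cvg_cst.
Qed.

(** First-order optimality at the minimizer: along the segment to any point
    of the epigraph the regularized value cannot decrease to first order. *)
Lemma prox_subgradient k a (b : K) x0 (c : K) : 0 < c ->
    lower_semicontinuous k -> convex_efun k -> dom k !=set0 ->
    (forall x, ((ip x a - b)%:E <= k x)%E) ->
  exists p (r : K), k p = r%:E /\ subdiff ip k p (c *: (x0 - p)).
Proof.
move=> c0 klsc kc kdom minor.
have [p [r [kpr pmin]]] := prox_minimizer x0 c0 klsc kc kdom minor.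
have above y (s : K) : (k y <= s%:E)%E -> r + ip (c *: (x0 - p)) (y - p) <= s.
  move=> kys.
  set D := s - r + c * ip (p - x0) (y - p).
  set E := c / 2 * `|y - p| ^+ 2.
  have E0 : 0 <= E by rewrite mulr_ge0 ?exprn_ge0// divr_ge0 ?(ltW c0).
  have DE (t : K) : 0 <= t <= 1 -> 0 <= t * (D + t * E).
    move=> t01; have := pmin _ _ (convex_efun_segment kc t01 kpr kys).
    rewrite (addrAC p) (sqr_normD (p - x0)) ipZr normrZ exprMn (real_normK (num_real t)).
    rewrite /D /E; nra.
  (* If [D] were negative, [t = - D / (E - D)] would make [D + t * E]
     negative. *)
  suff : 0 <= D by rewrite /D -(opprB p x0) scalerN ipNl ipZl; lra.
  rewrite leNgt; apply/negP => D0.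
  have ED : 0 < E - D by lra.
  have t0 : 0 < - D / (E - D) by rewrite divr_gt0// oppr_gt0.
  have t1 : - D / (E - D) <= 1 by rewrite ler_pdivrMr//; lra.
  have := DE (- D / (E - D)); rewrite (ltW t0) t1 => /(_ isT).
  rewrite pmulr_rge0// leNgt => /negP; apply.
  rewrite -(ltr_pM2r ED) mul0r mulrDl mulrAC divfK ?gt_eqF//; nra.
have kE : k p = r%:E.
  apply/eqP; rewrite eq_le kpr /=.
  have := above p; case: (k p) kpr (minor p) => //= s _ _ /(_ s (lexx _)).
  by rewrite subrr linear0r addr0.
exists p, r; split=> // y; rewrite kE -EFinD.
have := above y; case: (k y) (minor y) => [s _ /(_ s (lexx _))| |] //=.
by move=> *; rewrite leey.
Qed.

(** * Conjugates and subdifferentials *)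

Lemma le_of_real_ub (a b : \bar K) :
  (forall C : K, (b <= C%:E)%E -> (a <= C%:E)%E) -> (a <= b)%E.
Proof.
case: b => [b||] h; [exact: h|exact: leey|].
case: a h => [a||] h //.
  by have := h (a - 1)%R (leNye _); rewrite lee_fin lerDl oppr_ge0 ler10.
by have := h 0 (leNye _).
Qed.

(** A real bound on the conjugate is an affine minorant; with
    [le_of_real_ub] this replaces computations with suprema in [\bar K]. *)
Lemma fenchel_conj_leP k u (b : K) :
  (fenchel_conj ip k u <= b%:E)%E <-> forall x, ((ip x u - b)%:E <= k x)%E.
Proof.
split=> [h x|h].
  have /le_trans/(_ h) : ((ip x u)%:E - k x <= fenchel_conj ip k u)%E.
    by apply: ereal_sup_ubound; exists x.
  case: (k x) => [r||] //=; last by rewrite leey.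
  by rewrite -EFinB !lee_fin; lra.
apply: ge_ereal_sup => _ [x _ <-]; have := h x.
case: (k x) => [r||] //=; last by rewrite leNye.
by rewrite -EFinB !lee_fin; lra.
Qed.

Lemma fenchel_conj_gtNy k u : dom k !=set0 -> fenchel_conj ip k u != -oo%E.
Proof.
move=> [z kz]; rewrite -ltNye.
have : ((ip z u)%:E - k z <= fenchel_conj ip k u)%E.
  by apply: ereal_sup_ubound; exists z.
apply: lt_le_trans; move: kz; rewrite /dom /=.
by case: (k z) => [r||] //= _; rewrite ?ltNyr.
Qed.

Lemma dom_fenchel_conj k u : dom k !=set0 -> dom (fenchel_conj ip k) u ->
  exists b : K, fenchel_conj ip k u = b%:E.
Proof.
move=> /(fenchel_conj_gtNy u); rewrite /dom /=.
by case: (fenchel_conj ip k u) => [b||] // _ _; exists b.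
Qed.

(** The hard half of the Fenchel-Moreau theorem.  If [k x0] exceeded the
    value [C] of the biconjugate at [x0], then [k] would exceed [C] on a ball
    around [x0]; but [k] is at most [C] at every proximal point, and these enter
    the ball once the penalty [c] is large. *)
Lemma le_biconjugate k x0 : lower_semicontinuous k -> convex_efun k ->
    dom k !=set0 -> dom (fenchel_conj ip k) !=set0 ->
  (k x0 <= fenchel_conj ip (fenchel_conj ip k) x0)%E.
Proof.
move=> klsc kc kdom [a /(dom_fenchel_conj kdom)[b ab]].
have minor x : ((ip x a - b)%:E <= k x)%E.
  by apply/(fenchel_conj_leP k a b).1; rewrite ab.
apply: le_of_real_ub => C /fenchel_conj_leP hC.
rewrite leNgt; apply/negP => /klsc[V].
move=> /nbhs_ballP[dl /= dl0 ballV] VC.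
(* [B] bounds [(c - 2^-1) * `|x0 - p| ^+ 2] for every [c], and [c] is chosen
   so that this contradicts [dl <= `|x0 - p|]. *)
pose B := C + b - ip x0 a + `|a| ^+ 2 / 2.
have dl2 : 0 < dl ^+ 2 by rewrite exprn_gt0.
pose c := 2^-1 + (`|B| + 1) / dl ^+ 2.
have [c2 cdl] : 0 < c - 2^-1 /\ (c - 2^-1) * dl ^+ 2 = `|B| + 1.
  rewrite /c addrAC subrr add0r divfK ?gt_eqF//.
  by split=> //; rewrite divr_gt0// ltr_wpDl.
have c0 : 0 < c by lra.
clearbody c.
have [p [r [kp sub]]] := prox_subgradient x0 c0 klsc kc kdom minor.
have rC : r + c * `|x0 - p| ^+ 2 <= C.
  have : (fenchel_conj ip k (c *: (x0 - p)) <=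
      (ip p (c *: (x0 - p)) - r)%:E)%E.
    apply/fenchel_conj_leP => y; have := sub y; rewrite kp.
    by apply: le_trans; rewrite lee_fin ipBr !(ipC _ (c *: _)); lra.
  have := hC (c *: (x0 - p)) => /le_trans h /h; rewrite lee_fin (ipC p).
  by rewrite -ip_norm -ipZl ipBr; lra.
have xp : dl <= `|x0 - p|.
  rewrite leNgt; apply/negP => near.
  have := VC p (ballV _ _); rewrite kp lte_fin -ball_normE => /(_ near).
  by rewrite ltNge; nra.
have := minor p; rewrite kp lee_fin => rp.
have := sqr_ge0 `|(x0 - p) - a|; rewrite (sqr_normB (x0 - p)) ipBl => young.
have : dl ^+ 2 <= `|x0 - p| ^+ 2 by rewrite ler_pXn2r ?nnegrE ?(ltW dl0).
by rewrite -(ler_pM2l c2) cdl; have := ler_norm B; rewrite {1}/B; lra.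
Qed.

(** Equality in the Fenchel-Young inequality for the conjugate and its
    biconjugate becomes, by [le_biconjugate], equality for [k] itself. *)
Lemma subdiff_fenchel_conj k x u : lower_semicontinuous k -> convex_efun k ->
    dom k !=set0 -> dom (fenchel_conj ip k) !=set0 ->
  subdiff ip (fenchel_conj ip k) u x -> subdiff ip k x u.
Proof.
move=> klsc kc kdom kcdom sub.
have [b ub] : exists b : K, fenchel_conj ip k u = b%:E.
  apply: dom_fenchel_conj => //; have [v vdom] := kcdom.
  have [s vs] := dom_fenchel_conj kdom vdom.
  have := sub v; rewrite vs /dom /=.
  by case: (fenchel_conj ip k u) => [c||] //= _; rewrite ?ltry.
have kx : (k x <= (ip u x - b)%:E)%E.
  apply: le_trans (le_biconjugate x klsc kc kdom kcdom) _.
  apply/fenchel_conj_leP => v; apply: le_trans (sub v).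
  by rewrite ub lee_fin ipBr !(ipC x); lra.
have /fenchel_conj_leP minor : (fenchel_conj ip k u <= b%:E)%E by rewrite ub.
move=> y; apply: le_trans (minor y); apply: le_trans (leeD2r _ kx) _.
by rewrite lee_fin ipBr (ipC y); lra.
Qed.

(** Makes the affine minorants of a function minorants of its closed convex
    hull. *)
Lemma affine_lsc_convex u (b : K) :
  lower_semicontinuous (fun x => (ip x u - b)%:E) /\
  convex_efun (fun x => (ip x u - b)%:E).
Proof.
split.
  move=> x r; rewrite lte_fin => rx.
  have u1 : 0 < `|u| + 1 by rewrite ltr_wpDl.
  have gap : 0 < (ip x u - b - r) / (`|u| + 1).
    by rewrite divr_gt0 ?subr_gt0.
  exists (ball x ((ip x u - b - r) / (`|u| + 1))); first exact: nbhsx_ballx.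
  move=> y; rewrite -ball_normE /= ltr_pdivlMr// => xy.
  rewrite lte_fin; have := cauchy_schwarz (x - y) u; rewrite ipBl.
  by have := normr_ge0 (x - y); nra.
move=> [y s] [x r] t /set_mem/= ys /set_mem/= xr; apply/mem_set.
rewrite /epigraph /= !lee_fin in ys xr *.
have t0 : 0 <= t%:num by [].
have t1 : t%:num <= 1 by [].
have : forall t' a b' s' r' : K, 0 <= t' <= 1 -> a - b <= s' -> b' - b <= r' ->
    t' * a + (1 - t') * b' - b <= t' * s' + (1 - t') * r'.
  by move=> *; nra.
rewrite ipDl !ipZl; apply=> //; exact/andP.
Qed.

Lemma subdiff_fin k x u : (forall y, k y != -oo%E) -> dom k !=set0 ->
  subdiff ip k x u -> exists r : K, k x = r%:E.
Proof.
move=> kNy [z kz] /(_ z); move: kz (kNy x); rewrite /dom /=.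
by case: (k x) => [r||] //=; [exists r|case: (k z)].
Qed.

Lemma subdiff_monotone k x y u v : (forall z, k z != -oo%E) -> dom k !=set0 ->
  subdiff ip k x u -> subdiff ip k y v -> 0 <= ip (u - v) (x - y).
Proof.
move=> kNy kdom xu yv.
have [r kx] := subdiff_fin kNy kdom xu; have [s ky] := subdiff_fin kNy kdom yv.
have := xu y; have := yv x; rewrite kx ky !lee_fin -(opprB x y) linearNr ipBl.
lra.
Qed.

(** The infimal convolution with the indicator is constant along the orthogonal
    complement of [Y].  Hence its affine minorants are those of [f] whose slope
    is orthogonal to that complement, which means slope in [Y] because [Y] is
    itself an orthogonal complement; the closed convex hull has the same affine
    minorants. *)
Lemma fenchel_conj_inf_conv (A : set X) f : proper_efun f ->
  let Y := orthocomp ip A in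
  fenchel_conj ip (lsc_convex_hull (inf_conv f (indic_fun (orthocomp ip Y)))) =
  (fun u => fenchel_conj ip f u + indic_fun Y u)%E.
Proof.
move=> [fNy [z fz]] Y; set g := inf_conv _ _.
have gf x w : orthocomp ip Y w -> (g (x + w)%R <= f x)%E.
  move=> Yw; apply: ereal_inf_lbound; exists x => //.
  by rewrite addrAC subrr add0r /indic_fun mem_set// adde0.
apply/funext => u; apply/eqP; rewrite eq_le; apply/andP; split.
- rewrite /indic_fun; case: ifPn => [/set_mem Yu|_]; last first.
    by rewrite addey ?leey// fenchel_conj_gtNy//; exists z.
  rewrite adde0; apply: le_of_real_ub => b /fenchel_conj_leP minor.
  apply/fenchel_conj_leP => x.
  apply: (lsc_convex_hull_largest (h := fun x => (ip x u - b)%:E)).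
  have [l c] := affine_lsc_convex u b; split=> // {}x.
  apply: le_ereal_inf_tmp => _ [y _ <-]; rewrite /indic_fun.
  case: ifPn => [/set_mem /(_ u Yu)|_]; last by rewrite addey ?leey.
  by rewrite ipBl adde0 => xy; apply: le_trans (minor y); rewrite lee_fin; lra.
- apply: le_of_real_ub => C /fenchel_conj_leP minor.
  have below x w : orthocomp ip Y w -> ((ip (x + w) u - C)%:E <= f x)%E.
    move=> /(gf x); apply: le_trans; apply: le_trans (minor _) _.
    by have [_ _] := lsc_convex_hull_minorant g; apply.
  have uY : Y u.
    move=> w Aw; apply/eqP/negPn/negP => uw.
    have [r fzr] : exists r : K, f z = r%:E.
      by move: fz (fNy z); rewrite /dom /=; case: (f z) => // r; exists r.
    (* Moving from [z] along [w], far enough that the minorant exceeds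
       [f z = r] by one. *)
    have Yw : orthocomp ip Y ((r + C + 1 - ip z u) / ip u w *: w).
      by move=> v Yv; rewrite ipZl (ipC w) (Yv _ Aw) mulr0.
    have := below z _ Yw; rewrite fzr lee_fin ipDl ipZl (ipC w) divfK//; lra.
  rewrite /indic_fun mem_set// adde0; apply/fenchel_conj_leP => x.
  by have := below x 0 (fun v _ => linear0l _ v); rewrite addr0.
Qed.

(** * Isometries and the two inclusions *)

(** Expanding the squared norm of [R x - x] gives minus twice the inner
    product of [R x - x] and [x]. *)
Lemma isometry_dissipative (R : {linear X -> X}) x :
  `|R x| = `|x| -> 0 <= ip (R x - x) x -> R x = x.
Proof.
move=> Rx; rewrite ipBl ip_norm => Rxx.
apply/eqP; rewrite -subr_eq0 -normr_eq0 -sqrf_eq0 eq_le sqr_ge0 andbT.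
by rewrite sqr_normB Rx; lra.
Qed.

Lemma primal_solE (R : X -> X) f x : primal_sol ip R f x <->
  subdiff ip (lsc_convex_hull
    (inf_conv f (indic_fun (orthocomp ip (spaceY ip R))))) x (opS R x).
Proof.
split=> [[u xu [_ -> /eqP]]|xRx].
  by rewrite addr_eq0 opprB => /eqP uE; rewrite /opS -uE.
by exists (opS R x) => //; exists (x - R x) => //; rewrite addrA subrK subrr.
Qed.

Lemma dual_solE (R : {linear X -> X}) f y : dual_sol ip R f y <-> exists u,
  subdiff ip (fun y => fenchel_conj ip f y + indic_fun (spaceY ip R) y)%E y u /\
  y = opS R u.
Proof.
split=> [[u yu [v yE /eqP]]|[u [yu yE]]].
  rewrite addr_eq0 => /eqP uv; exists u; split=> //.
  by rewrite yE uv /opS linearN opprK addrC.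
exists u => //.
by exists (- u); rewrite ?subrr// yE /inverse_op /opIdR /= linearN opprK addrC.
Qed.

Lemma opSB (R : {linear X -> X}) u v :
  opS R u - opS R v = R (u - v) - (u - v).
Proof. by rewrite /opS (linearB R) !opprB /= addrACA [RHS]addrACA (addrC (- u)). Qed.

(** The conclusion of monotonicity for two solutions, confronted with
    dissipativity of [R - Id]. *)
Lemma isometry_monotone_eq (R : {linear X -> X}) u v :
    (forall x, `|R x| = `|x|) -> 0 <= ip (opS R u - opS R v) (u - v) ->
  R (u - v) = u - v.
Proof. by move=> iso; rewrite opSB; apply: isometry_dissipative. Qed.

End RealHilbert.

Theorem theorem3p5 (K : realType) (X : completeNormedModType K)
    (ip : {dot X for idfun})
    (ip_norm : forall x : X, ip x x = `|x| ^+ 2)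
    (m : nat) (m_gt0 : (0 < m)%N)
    (R : {linear X -> X})
    (R_isometry : forall x : X, `|R x| = `|x|)
    (R_period : forall x : X, iter m R x = x)
    (f : X -> \bar K) (f_Gamma0 : Gamma0 f)
    (Y_dom : spaceY ip R `&` dom (fenchel_conj ip f) !=set0)
    (e d : X) (ed : is_ed_pair ip m R f e d) :
  (primal_sol ip R f e /\ dual_sol ip R f d /\
   unique (dual_sol ip R f) d) /\
  (unique (fun p : X * X =>
       (primal_sol ip R f p.1 /\ spaceY ip R p.1) /\ dual_sol ip R f p.2) (e, d) /\
   unique (fun x : X => primal_sol ip R f x /\ spaceY ip R x) e /\
   unique (dual_sol ip R f) d).
Proof.
set Y := spaceY ip R in Y_dom *.
set h := fun y => (fenchel_conj ip f y + indic_fun Y y)%E.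
set k := lsc_convex_hull (inf_conv f (indic_fun (orthocomp ip Y))).
have [[fNy fdom] _ _] := f_Gamma0.
have kh : fenchel_conj ip k = h.
  exact: (fenchel_conj_inf_conv ip_norm (fix_set R) (conj fNy fdom)).
have hY y : Y y -> h y = fenchel_conj ip f y.
  by move=> Yy; rewrite /h /indic_fun mem_set// adde0.
have [klsc kc kg] := lsc_convex_hull_minorant (inf_conv f (indic_fun (orthocomp ip Y))).
have hdom : dom h !=set0.
  by have [y [Yy fy]] := Y_dom; exists y; rewrite /dom /= hY.
have kdom : dom k !=set0.
  have [z fz] := fdom; exists z; apply: le_lt_trans (kg z) _.
  apply: le_lt_trans fz; apply: ereal_inf_lbound; exists z => //.
  rewrite subrr /indic_fun mem_set ?adde0// => v _; exact: linear0l.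
have hNy y : h y != -oo%E by rewrite -kh fenchel_conj_gtNy.
(* A point of [dom h] is the slope of an affine minorant of [k]. *)
have kNy x : k x != -oo%E.
  have [a] := hdom; rewrite -kh => /(dom_fenchel_conj kdom)[b ab].
  have /fenchel_conj_leP/(_ x) : (fenchel_conj ip k a <= b%:E)%E by rewrite ab.
  by case: (k x).
have [Ye Yd [dS fd] _ edh] := ed.
have dh : subdiff ip h d e.
  move=> y; have [Yy|nYy] := pselect (Y y); last first.
    rewrite /h /indic_fun [X in (_ <= _ + X)%E]ifF ?addey ?leey//.
      exact: fenchel_conj_gtNy.
    by apply: memNset.
  have := edh y Yy; rewrite -dS !hY// ipC.
  have [b ->] := dom_fenchel_conj fdom fd.
  have := fenchel_conj_gtNy ip y fdom.
  case: (fenchel_conj ip f y) => [c _| |] //; last by rewrite leey.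
  by rewrite !lee_fin subr_le0.
have ke : subdiff ip k e d.
  by apply: (subdiff_fenchel_conj ip_norm); rewrite ?kh.
have dual_d : dual_sol ip R f d by apply/dual_solE; exists e.
have primal_e : primal_sol ip R f e by apply/primal_solE; rewrite -dS.
have dual_unique : unique (dual_sol ip R f) d.
  split=> // y /dual_solE[u [hu yS]].
  have := subdiff_monotone hNy hdom dh hu.
  rewrite ipC dS yS => /(isometry_monotone_eq ip_norm R_isometry).
  by move=> fix_eu; apply/eqP; rewrite -subr_eq0 opSB fix_eu subrr.
have primal_unique : unique (fun x => primal_sol ip R f x /\ Y x) e.
  split=> // x [/primal_solE kx Yx].
  have := subdiff_monotone kNy kdom ke kx.
  rewrite dS => /(isometry_monotone_eq ip_norm R_isometry) fix_ex.
  apply/eqP; rewrite -subr_eq0 -normr_eq0 -sqrf_eq0 -ip_norm ipBl.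
  by rewrite (Ye _ fix_ex) (Yx _ fix_ex) subrr.
split=> //; split=> //; split=> // -[x y] [] /=.
by move=> /primal_unique.2 -> /dual_unique.2 ->.
Qed.
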